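(* Let $p$ be a prime, let $k\geq 1$ be an integer, let $f\in F_p[x]$ be an irreducible polynomial of degree $k$, let $K_f=F_p[x]/(f)$ be the corresponding field with $p^k$ elements, and let $X_f$ be its undirected graph. The first non-trivial eigenvalue $\lambda_1$ of the Laplacian of $X_f$ satisfies $$\lambda_1\geq \frac{1}{p^{k+1}(2k+1)}.$$ In case $x$ is normal, $$\lambda_1\geq 4\sin^2(\pi/p).$$
   Context: $F_p$ is the field with $p$ elements, and the class of the polynomial $x$ in $K_f=F_p[x]/(f)$ is again denoted $x$. Let $S=\{x,x^p,x^{p^2},\dots,x^{p^{k-1}}\}\subset K_f$ be the set of conjugates of $x$. The element $x$ is normal if $S$ is a basis of $K_f$ as a vector space over $F_p$. The undirected multigraph $X_f$ has vertex set $K_f$ and the following edges. For all $y,z\in K_f$ and $s\in S$ with $z-y=s$ there is one (additive) edge between $y$ and $z$, for each such ordered pair $(y,z)$ and each $s$. For all $y,z\in K_f\setminus\{0\}$ and $s\in S$ with $zy^{-1}=s$ there is one (multiplicative) edge between $y$ and $z$, again for each such ordered pair and each $s$. Edges are counted with multiplicity (in particular, for $p=2$ the ordered pairs $(y,z)$ and $(z,y)$ with $z-y=s$ give two edges). The Laplacian acts on functions $g$ on the vertices by $\Delta g(y)=\sum (g(y)-g(z))$, where the sum is over the edges having one endpoint at $y$ and $z$ denotes the other endpoint (loops contribute nothing). It is symmetric and positive semi-definite. Its eigenvalues, listed with multiplicity, are $0=\lambda_0\leq\lambda_1\leq\cdots$, and $\lambda_1$ is the first non-trivial eigenvalue.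
   Formalization: The first inequality is stated for x nonzero in K_f, which excludes only f = cx (k = 1), where S = {0}, all edges are loops, the Laplacian is 0 and the claimed bound fails. *)

(* Defs.v *)
From HB Require Import structures.
From mathcomp Require Import all_boot all_order all_algebra all_field.
From mathcomp Require Import boolp classical_sets reals trigo.

Set Implicit Arguments.
Unset Strict Implicit.
Unset Printing Implicit Defensive.

Import Order.TTheory GRing.Theory Num.Theory.
Local Open Scope ring_scope.

(* [endpoints] is an ordered pair only for convenience: nothing below depends
   on the order of its two components.  Parallel edges are distinct elements
   of [edge], and an edge with equal endpoints is a loop. *)
Record multigraph (V : finType) := Multigraph {
  edge : finType;
  endpoints : edge -> V * V
}.

Definition incident (V : finType) (X : multigraph V) (e : edge X) (y : V) :=
  (y == (endpoints e).1) || (y == (endpoints e).2).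

(* Meaningful when [y] is an endpoint of [e]; equal to [y] if [e] is a loop. *)
Definition other_endpoint (V : finType) (X : multigraph V) (e : edge X)
    (y : V) : V :=
  if y == (endpoints e).1 then (endpoints e).2 else (endpoints e).1.

Definition laplacian_fun (R : realType) (V : finType) (X : multigraph V)
    (g : {ffun V -> R^o}) : {ffun V -> R^o} :=
  [ffun y => \sum_(e : edge X | incident e y) (g y - g (other_endpoint e y))].

Fact laplacian_fun_is_linear (R : realType) (V : finType) (X : multigraph V) :
  linear (@laplacian_fun R V X).
Proof.
move=> a g h; apply/ffunP=> y; rewrite !ffunE scaler_sumr -big_split /=.
apply: eq_bigr => e _; rewrite !ffunE scalerBr opprD !addrA.
by congr (_ + _); rewrite addrAC.
Qed.

HB.instance Definition _ (R : realType) (V : finType) (X : multigraph V) :=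
  GRing.isLinear.Build R {ffun V -> R^o} {ffun V -> R^o} *:%R
    (@laplacian_fun R V X) (@laplacian_fun_is_linear R V X).

Definition laplacian (R : realType) (V : finType) (X : multigraph V) :
    'End({ffun V -> R^o}) :=
  linfun (@laplacian_fun R V X).

(* [s] lists the eigenvalues of [phi] in nondecreasing order, each repeated
   according to the dimension of its eigenspace. *)
Definition is_spectrum (R : realType) (U : vectType R) (phi : 'End(U))
    (s : seq R) : Prop :=
  sorted <=%R s /\ forall a, count_mem a s = \dim (passmx.leigenspace phi a).

Definition spectrum (R : realType) (U : vectType R) (phi : 'End(U)) : seq R :=
  xget [::] [set s | is_spectrum phi s]%classic.

Lemma is_spectrum_uniq (R : realType) (U : vectType R) (phi : 'End(U))
    (s t : seq R) :
  is_spectrum phi s -> is_spectrum phi t -> s = t.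
Proof.
move=> [ss cs] [st ct]; apply: (sorted_eq le_trans le_anti ss st).
by apply/allP => a _ /=; rewrite cs ct.
Qed.

Lemma spectrumP (R : realType) (U : vectType R) (phi : 'End(U)) :
  is_spectrum phi (spectrum phi).
Proof.
suff [s Hs] : exists s, is_spectrum phi s.
  by rewrite /spectrum; case: xgetP => // /(_ s).
pose e := vbasis {:U}.
have eb : basis_of {:U} e := vbasisP _.
have [r Hr] : exists r : seq R, forall a, passmx.leigenvalue phi a -> a \in r.
  pose P := char_poly (passmx.mxof e e phi).
  have P0 : P != 0 by exact/monic_neq0/char_poly_monic.
  have rP a : passmx.leigenvalue phi a -> root P a.
    rewrite /passmx.leigenvalue (passmx.leigenspaceE eb).
    by rewrite passmx.vsof_eq0 // -eigenvalue_root_char.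
  have [//|nex] := pselect (exists r : seq R,
    forall a, passmx.leigenvalue phi a -> a \in r).
  have big n : exists r : seq R, [/\ size r = n, uniq r & all (root P) r].
    elim: n => [|n [r [sr ur ar]]]; first by exists [::].
    have [a [ea na]] : exists a, passmx.leigenvalue phi a /\ a \notin r.
      apply/not_existsP => H; apply: nex; exists r => a ea.
      by apply/negPn/negP => na; apply: (H a).
    by exists (a :: r); rewrite /= sr na ur rP.
  have [r [sr ur ar]] := big (size P).
  by have := max_poly_roots P0 ar ur; rewrite sr ltnn.
pose d a := \dim (passmx.leigenspace phi a).
exists (sort <=%R (flatten [seq nseq (d a) a | a <- undup r])).
split; first exact/sort_sorted/le_total.
move=> a; rewrite count_sort count_flatten -map_comp sumnE big_map.
under eq_bigr do rewrite /= count_nseq.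
have [ar|nar] := boolP (a \in undup r).
  rewrite (bigD1_seq a) ?undup_uniq //= eqxx mul1n big1 ?addn0 //.
  by move=> b /negPf ->.
rewrite big1_seq => [|b /= br]; last first.
  by case: eqP br nar => [-> ->|].
apply/esym/eqP; rewrite dimv_eq0; apply: contraNT nar => ea.
by rewrite mem_undup Hr.
Qed.

(* By convention 0 when [i] is at least the number of eigenvalues. *)
Definition lambda (R : realType) (V : finType) (X : multigraph V) (i : nat) : R :=
  (spectrum (laplacian R X))`_i.

(* The library's quotient {poly %/ h} is R[X]/(h) only for monic h, hence the
   normalization of f; it generates the same ideal as f. *)
Definition normalized (F : fieldType) (f : {poly F}) : {poly F} :=
  (lead_coef f)^-1 *: f.

Fact normalized_mi (F : fieldType) (f : {poly F}) :
  irreducible_poly f -> monic_irreducible_poly (normalized f).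
Proof.
move=> [sf irf].
have f0 : f != 0 by rewrite -size_poly_gt0 ltnW.
have lf : (lead_coef f)^-1 != 0 by rewrite invr_eq0 lead_coef_eq0.
split; last by rewrite monicE lead_coefZ mulVf ?lead_coef_eq0.
split; first by rewrite size_scale.
move=> q sq; rewrite dvdpZr // => qf.
by rewrite (eqp_trans (irf q sq qf)) // eqp_sym eqp_scale.
Qed.

Definition Kf (F : finFieldType) (f : {poly F}) (irr : irreducible_poly f) :=
  {poly %/ normalized f with normalized_mi irr}.

(* The class of the variable; it is 0 exactly when f is a scalar multiple of
   'X, in which case every edge of the graph below is a loop. *)
Definition Kf_x (F : finFieldType) (f : {poly F}) (irr : irreducible_poly f) :
  Kf irr := 'qX.

Definition conjugates (p k : nat) (K : finFieldType) (x : K) : {set K} :=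
  [set x ^+ (p ^ i) | i : 'I_k].

(* Edges are triples (y, z, s): one edge for each ordered pair (y, z) and each
   s in S. *)
Definition add_edge (K : finFieldType) (S : {set K}) : finType :=
  {e : K * K * K | (e.2 \in S) && (e.1.2 - e.1.1 == e.2)}.

Definition mul_edge (K : finFieldType) (S : {set K}) : finType :=
  {e : K * K * K | [&& e.1.1 != 0, e.1.2 != 0, e.2 \in S
                     & e.1.2 * e.1.1^-1 == e.2]}.

Definition edge_endpoints (K : finFieldType) (S : {set K})
    (e : add_edge S + mul_edge S) : K * K :=
  match e with inl a => (val a).1 | inr m => (val m).1 end.

Definition Xf (p k : nat) (f : {poly 'F_p}) (irr : irreducible_poly f) :
    multigraph (Kf irr) :=
  let S := conjugates p k (Kf_x irr) in
  @Multigraph (Kf irr) (add_edge S + mul_edge S)%type (@edge_endpoints _ S).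

Definition is_normal (p k : nat) (f : {poly 'F_p}) (irr : irreducible_poly f) :=
  basis_of {:Kf irr} (enum (conjugates p k (Kf_x irr))).

(* Main.v *)
Require Import Defs.
From mathcomp Require Import all_boot all_order all_algebra all_field.
From mathcomp Require Import complex ring lra.
From mathcomp Require Import reals trigo.
Import Order.TTheory GRing.Theory Num.Theory.
Local Open Scope ring_scope.

(* A lower bound for lambda_1 is a Poincare inequality: the Dirichlet energy of
   a mean-zero g dominates c * sum g^2.
   - General bound: Horner's scheme, using only the edges for s = x, walks from
     0 to any vertex in at most k p steps.  By Cauchy-Schwarz along a simple
     path, (g y - g 0)^2 <= k p * energy, and sum g^2 <= sum (g - g 0)^2 since g
     has mean zero; this gives the constant 1 / (k p^(k+1)).
   - Normal case: the additive edges alone suffice.  They form a Cayley graph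
     of F_p^k for a basis, which is diagonalized by the characters
     y |-> omega^(sum_i w_i y_i), omega = exp(2 i pi / p), and the eigenvalue
     for w <> 0 is at least |1 - omega^(w_i)|^2 for some w_i <> 0. *)

(** * Dirichlet energy and the spectrum of the Laplacian *)

(** Over [R[i]] the matrix is Hermitian, hence unitarily diagonalizable with real diagonal; if that
    diagonal were zero, [A] would be zero. *)
Lemma symmetric_eigenvalue_neq0 (R : rcfType) (n : nat) (A : 'M[R]_n) :
  A^T = A -> A != 0 -> exists2 a, a != 0 & eigenvalue A a.
Proof.
move=> symA A0.
pose B := map_mx (real_complex R) A.
have hermB : B \is hermsymmx.
  apply: realsym_hermsym.
    by apply/is_hermitianmxP; rewrite expr0 scale1r map_mx_id // map_trmx symA.
  by apply/mxOverP => i j; rewrite mxE; apply/complex_realP; exists (A i j).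
have /orthomx_spectralP defB := hermitian_normalmx hermB.
set P := spectralmx B in defB; set D := spectral_diag B in defB.
have Pu : P \in unitmx := spectral_unit B.
have [i Di0] : exists i, D 0 i != 0.
  apply/existsP; apply: contraR A0 => /existsPn D0.
  have D00 : D = 0.
    by apply/rowP => i; rewrite mxE; apply/eqP; move: (D0 i); rewrite negbK.
  rewrite -(map_mx_eq0 (real_complex R)) -/B defB D00.
  have -> : diag_mx (0 : 'rV[R[i]]_n) = 0.
    by apply/matrixP => j k; rewrite !mxE mul0rn.
  by rewrite mulmx0 mul0mx.
have /mxOverP/(_ 0 i)/complex_realP [a Da] := hermitian_spectral_diag_real hermB.
exists a; first by apply: contraNneq Di0 => a0; rewrite /D Da a0.
suff: eigenvalue B (D 0 i).
  by rewrite {1}/D Da; exact: etrans (esym (eigenvalue_map _ _ _)).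
apply/eigenvalueP; exists (row i P); last first.
  apply: contraTneq Pu => ri0; rewrite -row_free_unit; apply/row_freePn.
  by exists i; rewrite ri0 sub0mx.
rewrite -row_mul defB !mulmxA mulmxV // mul1mx row_mul row_diag_mx.
by rewrite -scalemxAl -rowE.
Qed.

(** The Dirichlet form, polarized; reversing an edge flips both factors, so the order of its
    endpoints is immaterial. *)
Definition energy {R : realType} {V : finType} (X : multigraph V)
    (g h : {ffun V -> R^o}) : R :=
  \sum_(e : edge X) (g (endpoints e).1 - g (endpoints e).2)
                    * (h (endpoints e).1 - h (endpoints e).2).

(** Discrete Green formula: after exchanging the sums, a non-loop edge meets exactly two vertices,
    whose terms combine into one product of differences; a loop gives 0. *)
Lemma laplacian_energy (R : realType) (V : finType) (X : multigraph V)
    (g h : {ffun V -> R^o}) :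
  \sum_y laplacian_fun X g y * h y = energy X g h.
Proof.
under eq_bigr => y _ do rewrite ffunE mulr_suml big_mkcond.
rewrite exchange_big; apply: eq_bigr => e _.
rewrite -big_mkcond /incident /other_endpoint.
case: (endpoints e) => u v /=.
have [<-|nuv] := eqVneq u v.
  rewrite subrr mul0r big1 // => y /orP[] /eqP ->; rewrite eqxx subrr mul0r //.
rewrite (bigD1 u) ?eqxx //= (big_pred1 v) => [|y]; last first.
  by rewrite /=; case: (eqVneq y u) => [->|_]; rewrite ?andbF ?andbT ?(negPf nuv).
by rewrite eq_sym (negPf nuv); ring.
Qed.

Lemma energyC (R : realType) (V : finType) (X : multigraph V)
    (g h : {ffun V -> R^o}) :
  energy X g h = energy X h g.
Proof. by apply: eq_bigr => e _; rewrite mulrC. Qed.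

Lemma ffun_sum_delta (R : realType) (V : finType) (g : {ffun V -> R^o}) :
  g = \sum_y g y *: [ffun z => (z == y)%:R].
Proof.
apply/ffunP => z; rewrite sum_ffunE (bigD1 z) //= big1 => [|y nyz].
  by rewrite !ffunE eqxx addr0 [RHS]mulr1.
by rewrite !ffunE eq_sym (negPf nyz) scaler0.
Qed.

Lemma mem_spectrum_laplacian (R : realType) (V : finType) (X : multigraph V)
    (a : R) :
  reflect (exists2 g : {ffun V -> R^o}, g != 0 & laplacian_fun X g = a *: g)
          (a \in spectrum (laplacian R X)).
Proof.
have [_ cs] := spectrumP (laplacian R X).
have kerP (g : {ffun V -> R^o}) :
    (g \in passmx.leigenspace (laplacian R X) a) = (laplacian_fun X g == a *: g).
  by rewrite memv_ker add_lfunE opp_lfunE scale_lfunE id_lfunE lfunE /= subr_eq0.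
rewrite -has_pred1 has_count cs.
apply: (iffP idP) => [|[g g0 /eqP Lg]]; last first.
  rewrite lt0n dimv_eq0; apply: contra g0 => /eqP E0.
  by move: Lg; rewrite -kerP E0 memv0.
rewrite lt0n dimv_eq0 -vpick0 => v0.
by exists (vpick (passmx.leigenspace (laplacian R X) a)) => //; apply/eqP;
  rewrite -kerP memv_pick.
Qed.

Lemma sum_sqr_gt0 (R : realType) (V : finType) (g : {ffun V -> R^o}) :
  g != 0 -> 0 < \sum_y g y ^+ 2.
Proof.
move=> g0; rewrite lt0r sumr_ge0 ?andbT => [|y _]; last exact: sqr_ge0.
apply: contra g0; rewrite psumr_eq0 => [/allP gy0|y _]; last exact: sqr_ge0.
apply/eqP/ffunP => y; rewrite ffunE; apply/eqP.
by rewrite -sqrf_eq0; have := gy0 y (mem_index_enum y).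
Qed.


(* Needed because [lambda] is 0 by convention past the end of the spectrum. *)
Lemma laplacian_nonzero_eigenvalue (R : realType) (V : finType)
    (X : multigraph V) (g : {ffun V -> R^o}) :
  energy X g g != 0 ->
  exists2 a, a != 0 & a \in spectrum (laplacian R X).
Proof.
move=> Eg.
pose d (y : V) : {ffun V -> R^o} := [ffun z => (z == y)%:R].
have Ld h w : laplacian_fun X h w = energy X h (d w).
  rewrite -laplacian_energy (bigD1 w) //= big1 => [|y nyw].
    by rewrite [d w w]ffunE eqxx mulr1 addr0.
  by rewrite [d w y]ffunE (negPf nyw) mulr0.
(* The Gram matrix of the energy on indicator functions, which is also the matrix of the
   Laplacian. *)
pose A := \matrix_(i < #|V|, j < #|V|) energy X (d (enum_val i)) (d (enum_val j)).
pose fn (v : 'rV[R]_#|V|) : {ffun V -> R^o} := [ffun y => v 0 (enum_rank y)].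
have fnA v : fn (v *m A) = laplacian_fun X (fn v).
  rewrite [in RHS](ffun_sum_delta _ _ (fn v)) linear_sum.
  apply/ffunP => y; rewrite ffunE mxE sum_ffunE.
  rewrite (reindex (@enum_rank V)) /=; last first.
    by apply: onW_bij; exact: enum_rank_bij.
  apply: eq_bigr => z _; rewrite linearZ /= [fn v z]ffunE mxE !enum_rankK -Ld.
  by rewrite [RHS]ffunE.
have fn_eq0 v : fn v = 0 -> v = 0.
  move=> /ffunP fv0; apply/rowP => i.
  by have := fv0 (enum_val i); rewrite !ffunE enum_valK => ->; rewrite mxE.
have [||a a0 /eigenvalueP[v vA v0]] := @symmetric_eigenvalue_neq0 R _ A.
- by apply/matrixP => i j; rewrite !mxE energyC.
- apply: contra Eg => /eqP A0; rewrite -laplacian_energy.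
  have -> : g = fn (\row_i g (enum_val i)).
    by apply/ffunP => y; rewrite ffunE mxE enum_rankK.
  rewrite -fnA A0 mulmx0; apply/eqP; rewrite big1 // => y _.
  by rewrite ffunE mxE mul0r.
- exists a => //; apply/mem_spectrum_laplacian; exists (fn v).
    by apply: contra v0 => /eqP/fn_eq0 ->.
  by rewrite -fnA vA; apply/ffunP => y; rewrite !ffunE mxE.
Qed.

Lemma laplacian_sum_eq0 (R : realType) (V : finType) (X : multigraph V)
    (g : {ffun V -> R^o}) : \sum_y laplacian_fun X g y = 0.
Proof.
transitivity (energy X g [ffun=> 1]); last first.
  by rewrite /energy big1 // => e _; rewrite !ffunE subrr mulr0.
rewrite -laplacian_energy; apply: eq_bigr => y _.
by rewrite [X in _ * X]ffunE mulr1.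
Qed.

Lemma energy_shift (R : realType) (V : finType) (X : multigraph V)
    (g : {ffun V -> R^o}) (c : R) :
  energy X [ffun y => g y - c] [ffun y => g y - c] = energy X g g.
Proof. by apply: eq_bigr => e _; rewrite !ffunE !opprB !addrA !subrK. Qed.

(** An eigenfunction for a nonzero eigenvalue has mean zero, so that eigenvalue is at least [c]; and
    0 is a simple eigenvalue, so it fills only one slot of the sorted list. *)
Lemma poincare_lambda1 (R : realType) (V : finType) (X : multigraph V) (c : R) :
  0 < c -> (1 < #|V|)%N ->
  (forall g : {ffun V -> R^o}, \sum_y g y = 0 ->
     c * \sum_y g y ^+ 2 <= energy X g g) ->
  c <= lambda R X 1.
Proof.
move=> c0 V1 poincare.
have energy_gt0 (g : {ffun V -> R^o}) :
    g != 0 -> \sum_y g y = 0 -> 0 < energy X g g.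
  move=> g0 /poincare; apply: lt_le_trans.
  by rewrite mulr_gt0 // sum_sqr_gt0.
have eig_energy (g : {ffun V -> R^o}) a : laplacian_fun X g = a *: g ->
    energy X g g = a * \sum_y g y ^+ 2.
  move=> Lg; rewrite -laplacian_energy Lg mulr_sumr; apply: eq_bigr => y _.
  by rewrite ffunE -mulrA -expr2.
have nz_ge a : a \in spectrum (laplacian R X) -> a != 0 -> c <= a.
  move=> /mem_spectrum_laplacian[g g0 Lg] a0.
  have sg0 : \sum_y g y = 0.
    apply: (mulfI a0); rewrite mulr0 mulr_sumr -[RHS](laplacian_sum_eq0 R V X g).
    by apply: eq_bigr => y _; rewrite Lg ffunE.
  by have := poincare _ sg0; rewrite (eig_energy _ _ Lg) ler_pM2r ?sum_sqr_gt0.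
have [ss cs] := spectrumP (laplacian R X).
(* A function in the kernel has zero energy; minus its mean [m], it would contradict the inequality
   unless it is constant. *)
have count0 : (count_mem 0%R (spectrum (laplacian R X)) <= 1)%N.
  rewrite cs; apply: (@leq_trans (\dim <[([ffun=> 1] : {ffun V -> R^o})]>)).
    apply/dimvS/subvP => g.
    rewrite memv_ker scale0r subr0 lfunE => /eqP /= Lg.
    have Eg : energy X g g = 0.
      by rewrite (eig_energy g 0) ?mul0r // Lg scale0r.
    pose m := (\sum_y g y) / #|V|%:R.
    have [h0|hN0] := eqVneq [ffun y => g y - m] (0 : {ffun V -> R^o}).
      apply/vlineP; exists m; apply/ffunP => y.
      move/ffunP/(_ y): h0; rewrite !ffunE => /eqP; rewrite subr_eq0 => /eqP ->.
      by rewrite [RHS]mulr1.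
    have := energy_gt0 _ hN0; rewrite energy_shift Eg ltxx => absurd.
    suff /absurd : \sum_y [ffun y => g y - m] y = 0 by [].
    under eq_bigr do rewrite ffunE.
    rewrite sumrB sumr_const -mulr_natr divfK ?subrr //.
    by rewrite pnatr_eq0 -lt0n ltnW.
  by rewrite dim_vline leq_b1.
have [y [z nyz]] : exists y z : V, y != z.
  have /card_gt1P[y [z [_ _ nyz]]] := V1.
  by exists y, z.
(* A nonzero function of mean zero has positive energy; this one yields a nonzero eigenvalue, so the
   list has a second entry besides 0. *)
pose g : {ffun V -> R^o} := [ffun x => (x == y)%:R - (x == z)%:R].
have g0 : g != 0.
  apply: contraTneq isT => /ffunP/(_ y); rewrite !ffunE eqxx (negPf nyz) subr0.
  by move/eqP; rewrite oner_eq0.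
have sg0 : \sum_x g x = 0.
  under eq_bigr do rewrite ffunE.
  have delta w : \sum_x (x == w)%:R = 1 :> R.
    by rewrite (bigD1 w) //= eqxx big1 ?addr0 // => x /negPf ->.
  by rewrite sumrB !delta subrr.
have Eg0 := lt0r_neq0 (energy_gt0 _ g0 sg0).
have [a a0 aS] := laplacian_nonzero_eigenvalue R V X g Eg0.
have S0 : 0 \in spectrum (laplacian R X).
  apply/mem_spectrum_laplacian; exists [ffun=> 1].
    apply/eqP => /ffunP/(_ y) /eqP; rewrite !ffunE; exact/negP/oner_neq0.
  rewrite scale0r; apply/ffunP => x; rewrite [LHS]ffunE [RHS]ffunE big1 // => e _.
  by rewrite !ffunE subrr.
rewrite /lambda; case: (spectrum _) ss count0 nz_ge aS S0 => [//|b [|d t]] /=.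
  by rewrite !inE => _ _ _ /eqP <- /eqP a0'; rewrite -a0' eqxx in a0.
move=> /andP[bd _] count0 nz_ge _ _.
(* If the second entry is 0, the first is nonzero, hence at least [c], and sortedness passes the
   bound on. *)
have [d0|d0] := eqVneq d 0; last by apply: nz_ge => //; rewrite !inE eqxx orbT.
have b0 : b != 0 by apply: contraTneq count0 => ->; rewrite d0 eqxx.
by apply: le_trans bd; apply: nz_ge => //; rewrite !inE eqxx.
Qed.

(** * Paths and the general bound *)

(* [F] is a weight on ordered pairs, but a step of the path may follow an edge in
   either direction; as the path is simple, it meets each pair at most once. *)
Lemma path_telescope_sqr (R : realFieldType) (T : eqType) (g : T -> R)
    (F : T -> T -> R)    (e : rel T) (u : T) (p : seq T) :
  (forall u v, 0 <= F u v) ->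
  (forall u v, e u v -> (g u - g v) ^+ 2 <= F u v + F v u) ->
  path e u p -> uniq (u :: p) ->
  (g (last u p) - g u) ^+ 2
    <= (size p)%:R * \sum_(v <- u :: p) \sum_(w <- u :: p) F v w.
Proof.
move=> F0 eF; elim: p u => [|v p IHp] u; first by rewrite subrr mul0r expr0n.
rewrite [path _ _ _]/= [last _ _]/= [size _]/= cons_uniq.
move=> /andP[uv pv] /andP[_ up].
have {IHp} := IHp v pv up.
set E := \sum_(_ <- _) _ => IHp; set E' := \sum_(_ <- _) _.
have E0 : 0 <= E by apply: sumr_ge0 => i _; apply: sumr_ge0.
(* Prepending [u] adds a row and a column to the double sum, and these contain [F u v] and
   [F v u]. *)
have EE' : E + (g u - g v) ^+ 2 <= E'.
  rewrite /E' big_cons; under [X in _ <= _ + X]eq_bigr do rewrite big_cons.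
  rewrite big_split /= addrA [leLHS]addrC lerD2r.
  rewrite [\sum_(j <- u :: _) _]big_cons big_cons [\sum_(j <- v :: _) _]big_cons.
  apply: le_trans (eF _ _ uv) _.
  have s1 : 0 <= \sum_(j <- p) F u j by apply: sumr_ge0.
  have s2 : 0 <= \sum_(j <- p) F j u by apply: sumr_ge0.
  have := F0 u u; lra.
move: E E' E0 EE' IHp => E E' E0 EE'.
move: (g (last v p)) (g v) (g u) EE' => c b a EE' IHp.
rewrite -natr1; move: (size p)%:R (ler0n R (size p)) IHp => n n0 IHp.
apply: (@le_trans _ _ ((n + 1) * (E + (a - b) ^+ 2))); last first.
  by rewrite ler_wpM2l // addr_ge0.
(* The weighted inequality below divides by [n]; for [n = 0] the induction hypothesis forces
   [c = b]. *)
have [n_eq0|n_neq0] := eqVneq n 0.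
  move: IHp; rewrite n_eq0 mul0r add0r mul1r real_exprn_even_le0 ?num_real //=.
  by rewrite subr_eq0 => /eqP ->; nra.
have n_gt0 : 0 < n by rewrite lt0r n_neq0.
rewrite -(ler_pM2l n_gt0).
(* (a - c)^2 <= (n + 1) ((a - b)^2 + (b - c)^2 / n), multiplied by n. *)
have := sqr_ge0 (n * (a - b) + (c - b)).
by nra.
Qed.

(** Cutting out cycles makes the path simple and no longer, and sums over its vertices are then
    partial sums over [T]. *)
Lemma path_sqr_le (R : realFieldType) (T : finType) (g : T -> R)
    (F : T -> T -> R) (e : rel T) (u : T) (p : seq T) :
  (forall u v, 0 <= F u v) ->
  (forall u v, e u v -> (g u - g v) ^+ 2 <= F u v + F v u) ->
  path e u p ->
  (g (last u p) - g u) ^+ 2 <= (size p)%:R * \sum_v \sum_w F v w.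
Proof.
move=> F0 eF /shortenP[q uq unq sub_qp].
have sum_uniq (h : T -> R) : (forall v, 0 <= h v) ->
    \sum_(v <- u :: q) h v <= \sum_v h v.
  move=> h0; rewrite big_uniq //= [leRHS](bigID [in u :: q]) /= lerDl.
  exact: sumr_ge0.
apply: le_trans (path_telescope_sqr _ _ _ _ _ _ _ F0 eF uq unq) _.
apply: ler_pM; rewrite ?ler0n ?ler_nat //.
- by apply: sumr_ge0 => v _; apply: sumr_ge0.
- by apply: uniq_leq_size => //; case/andP: unq.
apply: le_trans (sum_uniq _ _) => [|v]; last exact: sumr_ge0.
by apply: ler_sum => v _; apply: sum_uniq.
Qed.

(* At [u = 0] multiplication by [x] does not move, and is not an edge. *)
Definition horner_step (K : finFieldType) (x u v : K) : bool :=
  (v == u + x) || (u != 0) && (v == x * u).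

(** Each Horner digit [c] costs at most one multiplication and [c] additions, thus at most [B]
    steps. Since additions are of [x] and not of 1, the endpoint carries an extra factor [x]. *)
Lemma horner_walk (K : finFieldType) (x : K) (B : nat) (cs : seq nat) :
  all (fun c => c < B)%N cs ->
  exists p, [/\ path (horner_step K x) 0 p,
    last 0 p = x * foldr (fun c v => v * x + c%:R) 0 cs
    & (size p <= size cs * B)%N].
Proof.
elim: cs => [|c cs IHcs] /=; first by exists [::]; rewrite mulr0.
case/andP=> ltcB /IHcs[p [xp lastp szp]].
set v := x * foldr _ _ _ in lastp *.
have adds w : path (horner_step K x) w (traject (+%R^~ x) (w + x) c).
  elim: c w {ltcB} => //= n IHn w.
  by rewrite IHn andbT /horner_step eqxx.
have last_adds w : last w (traject (+%R^~ x) (w + x) c) = w + x *+ c.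
  rewrite last_traject; elim: c {ltcB adds} => [|n IHn] /=.
    by rewrite mulr0n addr0.
  by rewrite IHn mulrSr addrA.
exists (p ++ (if v == 0 then [::] else [:: x * v])
          ++ traject (+%R^~ x) (x * v + x) c).
rewrite !cat_path !last_cat lastp; split.
- rewrite xp /=; case: eqVneq => [v0|v0] /=; rewrite ?v0 ?mulr0 ?adds //.
  by rewrite /horner_step v0 eqxx orbT.
- have -> : x * (foldr (fun c v => v * x + c%:R) 0 cs * x + c%:R) = x * v + x *+ c.
    by rewrite [_ * x]mulrC mulrDr mulr_natr.
  by rewrite -last_adds; case: eqVneq => [->|]; rewrite ?mulr0.
- rewrite !size_cat size_traject mulSn addnC leq_add //.
  by case: ifP => _ /=; rewrite ?add0n ?add1n // ltnW.
Qed.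

(** An edge is determined by its source and its generator. The generator 0 gives no multiplicative
    edge, as its target would be 0. *)
Lemma energy_cayley (R : realType) (K : finFieldType) (S : {set K})
    (g : {ffun K -> R^o})
    (X := @Multigraph K (add_edge S + mul_edge S)%type (@edge_endpoints _ S)) :
  energy X g g = \sum_(s in S) \sum_y (g y - g (y + s)) ^+ 2
    + \sum_(s in S | s != 0) \sum_(y | y != 0) (g y - g (s * y)) ^+ 2.
Proof.
pose F (t : K * K * K) := (g t.1.1 - g t.1.2) ^+ 2.
rewrite /energy big_sumType /=; congr (_ + _).
  pose P := [pred t : K * K * K | (t.2 \in S) && (t.1.2 - t.1.1 == t.2)].
  transitivity (\sum_(t | P t) F t); first exact/esym/(big_sub P F).
  rewrite pair_big_dep /=.
  rewrite (reindex (fun q : K * K => (q.2, q.2 + q.1, q.1))) /=; last first.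
    exists (fun t => (t.2, t.1.1)) => [[s y]//|[[y z] s]] /=.
    by rewrite inE => /andP[_ /eqP /= <-]; rewrite addrC subrK.
  apply: eq_big => [[s y]|[s y] _] //=.
  by rewrite addrAC subrr add0r eqxx !andbT.
pose P := [pred t : K * K * K |
  [&& t.1.1 != 0, t.1.2 != 0, t.2 \in S & t.1.2 * t.1.1^-1 == t.2]].
transitivity (\sum_(t | P t) F t); first exact/esym/(big_sub P F).
rewrite pair_big_dep /=.
rewrite (reindex (fun q : K * K => (q.2, q.1 * q.2, q.1))) /=; last first.
  exists (fun t => (t.2, t.1.1)) => [[s y]//|[[y z] s]] /=.
  by rewrite inE => /and4P[/= y0 _ _ /eqP <-]; rewrite divfK.
apply: eq_big => [[s y]|[s y] _] //=.
have [->|y0] := eqVneq y 0; rewrite ?andbF /=; first by [].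
by rewrite mulf_eq0 (negPf y0) orbF mulfK // eqxx !andbT andbC.
Qed.

Lemma sum_sqr_le_shift (R : realFieldType) (T : finType) (g : T -> R) (c : R) :
  \sum_y g y = 0 -> \sum_y g y ^+ 2 <= \sum_y (g y - c) ^+ 2.
Proof.
move=> g0.
have -> : \sum_y (g y - c) ^+ 2
    = \sum_y g y ^+ 2 - (\sum_y g y) * c *+ 2 + \sum_(y : T) c ^+ 2.
  rewrite mulr_suml -sumrMnl -sumrB -big_split; apply: eq_bigr => y _.
  by rewrite sqrrB.
by rewrite g0 mul0r mul0rn subr0 lerDl; apply: sumr_ge0 => y _; exact: sqr_ge0.
Qed.

Lemma horner_energy_le (R : realType) (K : finFieldType) (S : {set K}) (x : K)
    (g : {ffun K -> R^o})
    (X := @Multigraph K (add_edge S + mul_edge S)%type (@edge_endpoints _ S)) :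
  x != 0 -> x \in S ->
  \sum_y (g y - g (y + x)) ^+ 2 + \sum_(y | y != 0) (g y - g (x * y)) ^+ 2
    <= energy X g g.
Proof.
move=> x0 xS; rewrite energy_cayley; apply: lerD.
  rewrite [leRHS](bigD1 x) //= lerDl.
  by apply: sumr_ge0 => s _; apply: sumr_ge0 => y _; exact: sqr_ge0.
rewrite [leRHS](bigD1 x) ?xS //= lerDl.
by apply: sumr_ge0 => s _; apply: sumr_ge0 => y _; exact: sqr_ge0.
Qed.

Lemma poincare_horner (R : realType) (K : finFieldType) (S : {set K}) (x : K)
    (D : nat) (g : {ffun K -> R^o})
    (X := @Multigraph K (add_edge S + mul_edge S)%type (@edge_endpoints _ S)) :
  x != 0 -> x \in S ->
  (forall y, exists p,
     [/\ path (horner_step K x) 0 p, last 0 p = y & (size p <= D)%N]) ->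
  \sum_y g y = 0 ->
  \sum_y g y ^+ 2 <= #|K|%:R * D%:R * energy X g g.
Proof.
move=> x0 xS walk g0.
(* The squared difference, weighted by the number of edges with [s = x] from [u] to [v]; the weight
   is 2 where both kinds of edge coincide. *)
pose F u v := ((v == u + x)%:R + ((u != 0) && (v == x * u))%:R) * (g u - g v) ^+ 2.
have F0 u v : 0 <= F u v by rewrite mulr_ge0 ?sqr_ge0 // addr_ge0 ?ler0n.
have stepF u v : horner_step K x u v -> (g u - g v) ^+ 2 <= F u v + F v u.
  move=> uv; apply: (@le_trans _ _ (F u v)); last by rewrite lerDl.
  rewrite ler_peMl ?sqr_ge0 // -natrD ler1n addn_gt0 !lt0b.
  exact: uv.
have sumF : \sum_u \sum_v F u v <= energy X g g.
  apply: le_trans (horner_energy_le R K S x g x0 xS).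
  rewrite [X in _ <= _ + X]big_mkcond -big_split; apply: ler_sum => u _ /=.
  under eq_bigr do rewrite /F mulrDl.
  rewrite big_split /= (bigD1 (u + x)) //= eqxx mul1r big1 ?addr0; last first.
    by move=> v /negPf->; rewrite mul0r.
  rewrite lerD2l; case: eqVneq => u0 /=.
    by rewrite big1 // => v _; rewrite mul0r.
  rewrite (bigD1 (x * u)) //= eqxx mul1r big1 ?addr0 // => v /negPf->.
  by rewrite mul0r.
apply: le_trans (sum_sqr_le_shift _ _ g (g 0) g0) _.
rewrite -mulrA mulr_natl -sumr_const; apply: ler_sum => y _.
have [p [xp <- szp]] := walk y.
apply: le_trans (path_sqr_le _ _ g F (horner_step K x) 0 p F0 stepF xp) _.
by apply: ler_pM; rewrite ?ler0n ?ler_nat // sumr_ge0 // => u _; rewrite sumr_ge0.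
Qed.

(** Coefficients become natural numbers because the walk adds [x] a natural number of times per
    digit. *)
Lemma in_qpoly_horner (p : nat) (h : {poly 'F_p}) (q : {poly 'F_p}) :
  in_qpoly h q =
  foldr (fun c v => v * 'qX + c%:R) 0 [seq val c | c <- polyseq q] :> {poly %/ h}.
Proof.
rewrite -[in LHS](polyseqK q); elim: (polyseq q) => [|c s IHs] /=.
  exact: in_qpoly0.
rewrite cons_poly_def rmorphD rmorphM /= IHs; congr (_ + _).
by rewrite -[in LHS](natr_Zp c) polyC_natr rmorph_nat.
Qed.

Lemma Kf_horner_walk (p k : nat) (f : {poly 'F_p}) (f_irr : irreducible_poly f)
    (y : Kf f_irr) :
  prime p -> size f = k.+1 -> Kf_x f_irr != 0 ->
  exists q, [/\ path (horner_step (Kf f_irr) (Kf_x f_irr)) 0 q,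
                last 0 q = y & (size q <= k * p)%N].
Proof.
move=> p_prime sf x0; set x := Kf_x f_irr in x0 *.
(* The walk reaches [x] times the value of its digits, so the digits are taken from [x^-1 * y]. *)
pose z := x^-1 * y.
pose h := normalized f.
have mh : mk_monic h = h by apply: mk_monicE; exact: normalized_mi.
have sh : size h = k.+1.
  by rewrite size_scale // invr_eq0 lead_coef_eq0 -size_poly_eq0 sf.
have zE : z = in_qpoly h (val z).
  by apply: val_inj; apply/esym/in_qpoly_small/size_mk_monic.
have [|q [xq lastq szq]] := horner_walk _ x p [seq val c | c <- polyseq (val z)].
  apply/allP => _ /mapP[c _ ->].
  by rewrite -[X in (_ < X)%N](Fp_cast p_prime) ltn_ord.
exists q; split => //.
  rewrite lastq; have := in_qpoly_horner p h (val z); rewrite -zE.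
  by move=> <-; rewrite /z mulVKf.
apply: leq_trans szq _; rewrite size_map leq_mul2r.
by rewrite (leq_trans (size_npoly z)) ?orbT // mh sh.
Qed.

(** * Fourier analysis on a finite abelian group *)

(** Expanding the square leaves orthogonality of characters: if [y != z], some [chi w (y - z)]
    differs from 1, and translating the index by [w] multiplies the sum by that value, so the sum is
    0. *)
Lemma parseval (C : numClosedFieldType) (K W : finZmodType)
    (chi : W -> K -> C) (f : K -> C) :
  (forall w y, `|chi w y| = 1) ->
  (forall w w' y, chi (w + w') y = chi w y * chi w' y) ->
  (forall w y z, chi w (y + z) = chi w y * chi w z) ->
  (forall y, y != 0 -> exists w, chi w y != 1) ->
  \sum_w `|\sum_y f y * chi w y| ^+ 2 = #|W|%:R * \sum_y `|f y| ^+ 2.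
Proof.
move=> chi1 chiDl chiDr sep.
have chi_neq0 w y : chi w y != 0 by rewrite -normr_eq0 chi1 oner_neq0.
have chi0 w : chi w 0 = 1.
  by apply: (mulfI (chi_neq0 w 0)); rewrite -chiDr addr0 mulr1.
have chiC w y : (chi w y)^* = chi w (- y).
  apply: (mulfI (chi_neq0 w y)).
  by rewrite -normCK chi1 expr1n -chiDr subrr chi0.
have orth y z : \sum_w chi w y * (chi w z)^* = if z == y then #|W|%:R else 0.
  under eq_bigr do rewrite chiC -chiDr.
  case: eqVneq => [->|nzy].
    by rewrite subrr (eq_bigr _ (fun w _ => chi0 w)) sumr_const.
  have /sep[w chiw] : y - z != 0 by rewrite subr_eq0 eq_sym.
  apply/eqP; move: chiw; apply: contraNT => S0.
  apply/eqP/(mulIf S0); rewrite mul1r mulr_sumr.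
  rewrite [RHS](reindex_inj (addrI w)) /=.
  by apply: eq_bigr => v _; rewrite chiDl.
under eq_bigr => w _.
  rewrite normCK rmorph_sum big_distrlr /=.
  under eq_bigr do under eq_bigr do rewrite rmorphM mulrACA.
  over.
rewrite exchange_big mulr_sumr; apply: eq_bigr => y _ /=.
rewrite exchange_big (bigD1 y) //= -mulr_sumr orth eqxx big1 => [|z nzy].
  by rewrite addr0 normCK mulrC.
by rewrite -mulr_sumr orth (negPf nzy) mulr0.
Qed.

(** The transform turns translation by [b i] into multiplication by [(chi w (b i))^-1], so Parseval
    reduces the inequality to one [w] at a time; at [w = 0] the transform is the sum of [f], which
    vanishes. *)
Lemma poincare_characters (C : numClosedFieldType) (K W : finZmodType)
    (I : finType) (b : I -> K) (chi : W -> K -> C) (c : C) (f : K -> C) :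
  (forall w y, `|chi w y| = 1) ->
  (forall w w' y, chi (w + w') y = chi w y * chi w' y) ->
  (forall w y z, chi w (y + z) = chi w y * chi w z) ->
  (forall y, y != 0 -> exists w, chi w y != 1) ->
  (forall w, w != 0 -> c <= \sum_i `|1 - chi w (b i)| ^+ 2) ->
  \sum_y f y = 0 ->
  c * \sum_y `|f y| ^+ 2 <= \sum_i \sum_y `|f y - f (y + b i)| ^+ 2.
Proof.
move=> chi1 chiDl chiDr sep gap f0.
have chi_neq0 w y : chi w y != 0 by rewrite -normr_eq0 chi1 oner_neq0.
have chi0 y : chi 0 y = 1.
  by apply: (mulfI (chi_neq0 0 y)); rewrite -chiDl addr0 mulr1.
have W0 : 0 < #|W|%:R :> C by rewrite ltr0n; apply/card_gt0P; exists 0.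
rewrite -(ler_pM2l W0) mulrCA -(parseval _ _ _ chi f) // !mulr_sumr.
under [leRHS]eq_bigr do rewrite -(parseval _ _ _ chi) //.
rewrite [leRHS]exchange_big /=; apply: ler_sum => w _.
have transl i : \sum_y (f y - f (y + b i)) * chi w y
    = (1 - (chi w (b i))^-1) * \sum_y f y * chi w y.
  under eq_bigr do rewrite mulrBl.
  rewrite sumrB mulrBl mul1r; congr (_ - _).
  rewrite [in RHS](reindex_inj (addIr (b i))) mulr_sumr /=.
  by apply: eq_bigr => y _; rewrite chiDr [chi w y * _]mulrC mulrCA mulKf.
under [leRHS]eq_bigr do rewrite transl normrM exprMn.
rewrite -mulr_suml; have [->|w0] := eqVneq w 0.
  rewrite (eq_bigr f) => [|y _]; last by rewrite chi0 mulr1.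
  by rewrite f0 normr0 expr0n !mulr0.
apply: ler_wpM2r; first by rewrite exprn_ge0.
apply: le_trans (gap w w0) _; apply: ler_sum => i _.
(* As [chi w (b i)] has modulus 1, it and its inverse are equally far from 1. *)
have -> : 1 - (chi w (b i))^-1 = - ((1 - chi w (b i)) / chi w (b i)).
  by rewrite mulrBl mul1r mulfV // opprB.
by rewrite normrN normf_div chi1 divr1.
Qed.

(** * Characters of ['F_p] and the constant [4 * sin (pi / p) ^+ 2] *)

Lemma expr_cos_sin (R : realType) (t : R) (n : nat) :
  (cos t +i* sin t)%C ^+ n = (cos (t *+ n) +i* sin (t *+ n))%C.
Proof.
elim: n => [|n IHn]; first by rewrite expr0 mulr0n cos0 sin0.
rewrite exprS IHn mulrS cosD sinD; apply/eqP.
by rewrite eq_complex /= eqxx addrC eqxx.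
Qed.

Lemma norm_cos_sin (R : realType) (t : R) : `|(cos t +i* sin t)%C| = 1.
Proof. by rewrite normc_def /= cos2Dsin2 sqrtr1. Qed.

Lemma norm_one_sub_cos_sin (R : realType) (t : R) :
  `|1 - (cos (t *+ 2) +i* sin (t *+ 2))%C| ^+ 2 = (4 * sin t ^+ 2)%:C%C.
Proof.
rewrite -add_Re2_Im2; congr (_%:C)%C => /=.
rewrite sub0r sqrrN (sin2cos2 (t *+ 2)) cos_mulr2n cos2sin2.
by ring.
Qed.

(** With [t = pi / p], it suffices that [|cos (t *+ a)| <= cos t]. Cosine decreases on [0, pi],
    which bounds [cos (t *+ b)] for [0 < b < p]; taking [b = p - a] handles the opposite sign. *)
Lemma sin_pi_div_ge (R : realType) (p a : nat) : (0 < a < p)%N ->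
  sin (pi / p%:R : R) ^+ 2 <= sin (pi / p%:R *+ a) ^+ 2.
Proof.
case/andP=> a0 ap.
have p0 : 0 < p%:R :> R by rewrite ltr0n (leq_trans _ ap).
set t : R := pi / p%:R.
have t0 : 0 < t by rewrite divr_gt0 ?pi_gt0.
have tp : t *+ p = pi by rewrite -mulr_natr divfK ?lt0r_neq0.
move: t t0 tp => t t0 tp.
have cos_le (b : nat) : (0 < b < p)%N -> cos (t *+ b) <= cos t.
  case/andP=> b0 bp.
  rewrite leNgt ltr_cos ?in_itv /= ?mulrn_wge0 ?(ltW t0) //= -?tp.
  - by rewrite -leNgt; exact: (ler_wpMn2l (ltW t0) b0).
  - exact: (ler_wpMn2l (ltW t0) (ltnW bp)).
  - exact: (ler_wpMn2l (ltW t0) (leq_trans a0 (ltnW ap) : (1 <= p)%N)).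
have cosB : - cos (t *+ a) <= cos t.
  have -> : - cos (t *+ a) = cos (t *+ (p - a)).
    by rewrite mulrnBr 1?ltnW // tp [pi - _]addrC cosDpi cosN.
  by apply: cos_le; rewrite subn_gt0 ap ltn_subrL a0 (leq_trans _ ap).
have := cos_le a; rewrite a0 ap => /(_ isT) cosA.
by rewrite !sin2cos2 lerD2l lerN2; nra.
Qed.

(** The additive character sending [a] to exp(2 i pi a / p), with [a] read as its natural
    representative. *)
Definition Fp_char (R : realType) (p : nat) (a : 'F_p) : R[i] :=
  let t : R := pi / p%:R *+ 2 in (cos t +i* sin t)%C ^+ a.

Lemma norm_Fp_char (R : realType) (p : nat) (a : 'F_p) : `|Fp_char R p a| = 1.
Proof. by rewrite normrX norm_cos_sin expr1n. Qed.

Lemma Fp_charD (R : realType) (p : nat) (a b : 'F_p) : prime p ->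
  Fp_char R p (a + b) = Fp_char R p a * Fp_char R p b.
Proof.
move=> p_prime; rewrite /Fp_char -exprD /=.
set z := (_ +i* _)%C.
(* Addition in ['F_p] reduces exponents modulo this successor, which equals [p]. *)
have zp : z ^+ (Zp_trunc (pdiv p)).+2 = 1.
  rewrite Fp_cast // /z expr_cos_sin mulrnAC -[_ *+ p]mulr_natr divfK.
    by rewrite cos2pi sin2pi.
  by rewrite pnatr_eq0 -lt0n prime_gt0.
by rewrite -[RHS](expr_mod _ zp).
Qed.

Lemma Fp_char_gap (R : realType) (p : nat) (a : 'F_p) : prime p -> a != 0 ->
  ((4 * sin (pi / p%:R) ^+ 2)%:C)%C <= `|1 - Fp_char R p a| ^+ 2.
Proof.
move=> p_prime a0.
rewrite /Fp_char expr_cos_sin mulrnAC norm_one_sub_cos_sin lecR ler_pM2l //.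
by apply: sin_pi_div_ge; rewrite lt0n a0 -[X in (_ < X)%N](Fp_cast p_prime) ltn_ord.
Qed.

Lemma sin_pi_div_gt0 (R : realType) (p : nat) : (1 < p)%N ->
  0 < 4 * sin (pi / p%:R : R) ^+ 2.
Proof.
move=> p1; rewrite mulr_gt0 // exprn_gt0 // sin_gt0_pi //.
have p0 : 0 < p%:R :> R by rewrite ltr0n ltnW.
by rewrite divr_gt0 ?pi_gt0 // ltr_pdivrMr // ltr_pMr ?pi_gt0 // ltr1n.
Qed.

(** The maps [x i] are the coordinates dual to [b]. A nonzero [w] has some [w 0 i != 0], and the
    value of its character at [b i] alone supplies the gap. *)
Lemma poincare_basis (R : realType) (p : nat) (V : finZmodType) (n : nat)
    (b : 'I_n -> V) (x : 'I_n -> V -> 'F_p) (g : V -> R) :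
  prime p ->
  (forall i y z, x i (y + z) = x i y + x i z) ->
  (forall i j, x i (b j) = (i == j)%:R) ->
  (forall y, (forall i, x i y = 0) -> y = 0) ->
  \sum_y g y = 0 ->
  4 * sin (pi / p%:R) ^+ 2 * \sum_y g y ^+ 2
    <= \sum_i \sum_y (g y - g (y + b i)) ^+ 2.
Proof.
move=> p_prime xD xb x_eq0 g0.
pose chi (w : 'rV['F_p]_n) y := Fp_char R p (\sum_i w 0 i * x i y).
have chib w i : chi w (b i) = Fp_char R p (w 0 i).
  rewrite /chi (bigD1 i) //= xb eqxx mulr1 big1 ?addr0 // => j nji.
  by rewrite xb (negPf nji) mulr0.
have c0 := sin_pi_div_gt0 R p (prime_gt1 p_prime).
have sqC (r : R) : `|r%:C%C| ^+ 2 = (r ^+ 2)%:C%C.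
  by rewrite -add_Re2_Im2 /= expr0n addr0.
rewrite -lecR rmorphM /=.
have -> : (\sum_y g y ^+ 2)%:C%C = \sum_y `|(g y)%:C%C| ^+ 2.
  by rewrite rmorph_sum; apply: eq_bigr => y _; rewrite sqC.
have -> : (\sum_i \sum_y (g y - g (y + b i)) ^+ 2)%:C%C
    = \sum_i \sum_y `|(g y)%:C%C - (g (y + b i))%:C%C| ^+ 2.
  rewrite rmorph_sum; apply: eq_bigr => i _.
  by rewrite rmorph_sum; apply: eq_bigr => y _; rewrite -rmorphB sqC.
apply: (poincare_characters _ _ _ _ b chi _ (fun y => (g y)%:C%C)).
- by move=> w y; exact: norm_Fp_char.
- move=> w w' y; rewrite -Fp_charD // -big_split; congr Fp_char.
  by apply: eq_bigr => i _; rewrite mxE mulrDl.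
- move=> w y z; rewrite -Fp_charD // -big_split; congr Fp_char.
  by apply: eq_bigr => i _; rewrite xD mulrDr.
- move=> y y0.
  have [i xi0] : exists i, x i y != 0.
    apply/existsP; apply: contraR y0 => /existsPn xy0.
    by apply/eqP/x_eq0 => i; apply/eqP; have := xy0 i; rewrite negbK.
  exists (delta_mx 0 i).
  have -> : chi (delta_mx 0 i) y = Fp_char R p (x i y).
    congr Fp_char; rewrite (bigD1 i) //= mxE !eqxx mul1r big1 ?addr0 // => j nji.
    by rewrite mxE (negPf nji) andbF mul0r.
  apply: contraTneq (Fp_char_gap R p _ p_prime xi0) => ->.
  by rewrite subrr normr0 expr0n /= lecR -ltNge.
- move=> w w0.
  have [i wi0] : exists i, w 0 i != 0.
    by case/rV0Pn: w0 => i wi0; exists i.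
  apply: le_trans (Fp_char_gap R p _ p_prime wi0) _.
  by rewrite (bigD1 i) //= chib lerDl sumr_ge0 // => j _; rewrite exprn_ge0.
- by rewrite -rmorph_sum g0.
Qed.

(** * Application to [Xf] *)

(** For [x = 0] every edge is a loop and the first non-trivial eigenvalue is 0, hence the guard on
    the first bound. *)
Theorem proposition8 (R : realType) (p k : nat) (f : {poly 'F_p})
    (p_prime : prime p) (k_ge1 : (1 <= k)%N)
    (f_irr : irreducible_poly f) (deg_f : size f = k.+1) :
  (Kf_x f_irr != 0 ->
     1 / ((p%:R ^+ k.+1) * (2 * k%:R + 1)) <= lambda R (Xf k f_irr) 1)
  /\
  (is_normal k f_irr ->
     4 * sin (pi / p%:R) ^+ 2 <= lambda R (Xf k f_irr) 1).
Proof.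
have cardK : #|Kf f_irr| = (p ^ k)%N.
  rewrite card_qfpoly card_Fp // size_scale ?deg_f //.
  by rewrite invr_eq0 lead_coef_eq0 -size_poly_eq0 deg_f.
have K_gt1 : (1 < #|Kf f_irr|)%N.
  by rewrite cardK -(exp1n k) ltn_exp2r // prime_gt1.
have p0 : 0 < p%:R :> R by rewrite ltr0n prime_gt0.
split => [x0|Kf_normal].
  have k0 : 0 < 2 * k%:R + 1 :> R by rewrite ltr_wpDl // mulr_ge0.
  have c0 : 0 < p%:R ^+ k.+1 * (2 * k%:R + 1) :> R by rewrite mulr_gt0 // exprn_gt0.
  apply: poincare_lambda1 => [|//|g g0]; first by rewrite divr_gt0.
  rewrite div1r ler_pdivrMl //.
  have xS : Kf_x f_irr \in conjugates p k (Kf_x f_irr).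
    by apply/imsetP; exists (Ordinal k_ge1); rewrite //= expn0 expr1.
  have walk y := Kf_horner_walk p k f f_irr y p_prime deg_f x0.
  have := poincare_horner R (Kf f_irr) _ _ (k * p) g x0 xS walk g0.
  move/le_trans; apply; apply: ler_wpM2r.
    by apply: sumr_ge0 => e _; rewrite -expr2 sqr_ge0.
  (* The walk yields the factor [p ^ k * (k * p)], and [k <= 2 * k + 1]. *)
  rewrite cardK natrX natrM exprSr -mulrA ler_pM2l ?exprn_gt0 //.
  by rewrite mulrC ler_pM2l //; have := ler0n R k; lra.
apply: poincare_lambda1 => [|//|g g0].
  exact/sin_pi_div_gt0/prime_gt1.
set S := conjugates p k (Kf_x f_irr) in Kf_normal *.
have E0 : 0 <= \sum_(s in S | s != 0) \sum_(y | y != 0) (g y - g (s * y)) ^+ 2.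
  by apply: sumr_ge0 => s _; apply: sumr_ge0 => y _; exact: sqr_ge0.
rewrite energy_cayley -[leLHS]addr0; apply: lerD E0.
(* Enumerating [S] turns the sum over conjugates into one indexed by the basis vectors. *)
rewrite -[leRHS]big_enum /= [leRHS]big_tnth.
pose b := in_tuple (enum S).
have freeb : free b := basis_free Kf_normal.
apply: (poincare_basis R p (Kf f_irr) _ (tnth b) (fun i y => coord b i y) g) => //.
- by move=> i y z; rewrite linearD.
- by move=> i j; rewrite (tnth_nth 0) coord_free // eq_sym.
- move=> y y0; have basisb : basis_of fullv b := Kf_normal.
  by rewrite (coord_basis basisb (memvf y)) big1 // => i _; rewrite y0 scale0r.
Qed.
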